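(* Let $\Bbbk$ be a field of characteristic $0$. Let $T$ be a well-covered tree with at least two vertices. Then $A_{\mathrm c}(T)$ has the weak Lefschetz property (WLP) if and only if $T\cong K_2$ or $T\cong P_4$.
   Context: A graph is well-covered if all of its maximal (with respect to inclusion) independent sets have the same cardinality. $K_2$ is the graph with two vertices joined by an edge, and $P_4$ is the path on four vertices. A vertex cover of a graph $G$ is a set of vertices meeting every edge. For a finite simple graph $G$ with vertices labelled $1,\dots,n$, let $R=\Bbbk[x_1,\dots,x_n]$ with the standard grading, $x_C=\prod_{i\in C}x_i$, $J(G)=(x_C : C\text{ a vertex cover of }G)\subset R$, and $A_{\mathrm c}(G)=R/\big((x_1^2,\dots,x_n^2)+J(G)\big)$. A standard graded Artinian $\Bbbk$-algebra $A=\bigoplus_i[A]_i$ has the WLP if there is a linear form $\ell\in[A]_1$ such that for every $i$ the multiplication map $\cdot\ell:[A]_i\to[A]_{i+1}$ is injective or surjective. *)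

(* Defs.v *)
From HB Require Import structures.
From mathcomp Require Import all_boot all_order all_algebra.
From mathcomp Require Import generic_quotient ring_quotient.
From mathcomp.classical Require boolp.
From mathcomp.multinomials Require Export mpoly.

Set Implicit Arguments.
Unset Strict Implicit.
Unset Printing Implicit Defensive.

Import GRing.Theory.
Local Open Scope quotient_scope.
Local Open Scope ring_scope.

(* A simple graph on the finite vertex type V is a symmetric irreflexive
   relation e : rel V, with e x y meaning that xy is an edge. *)
Section Graphs.
Variables (V : finType) (e : rel V).

Definition independent (A : {set V}) : bool :=
  [forall x in A, forall y in A, ~~ e x y].

Definition well_covered : Prop :=
  forall A B : {set V},
    maxset independent A -> maxset independent B -> #|A| = #|B|.

Definition vertex_cover (C : {set V}) : bool :=
  [forall x, forall y, e x y ==> (x \in C) || (y \in C)].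

(* For a symmetric e every edge xy yields the duplicate-free closed walk
   [:: x; y], so only those of length at least 3 are cycles of the graph. *)
Definition acyclic : Prop := forall c : seq V, ucycle e c -> (size c <= 2)%N.

Definition is_tree : Prop :=
  [/\ (0 < #|V|)%N, forall x y, connect e x y & acyclic].

End Graphs.

Definition graph_iso (V W : finType) (e : rel V) (f : rel W) : Prop :=
  exists2 h : V -> W, bijective h & forall x y, f (h x) (h y) = e x y.

Definition K2 : rel 'I_2 := fun x y => x != y.

Definition P4 : rel 'I_4 :=
  fun x y => (x.+1 == y :> nat) || (y.+1 == x :> nat).

Section IdealQuotient.
Variable R : comNzRingType.

Definition in_ideal (gs : seq R) (f : R) : Prop :=
  exists c : nat -> R, f = \sum_(i < size gs) c i * gs`_i.

Definition ideal (gs : seq R) : {pred R} := fun f => boolp.asbool (in_ideal gs f).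

Lemma idealP gs f : reflect (in_ideal gs f) (f \in ideal gs).
Proof. exact: boolp.asboolP. Qed.

Lemma ideal_zmod_closed gs : zmod_closed (ideal gs).
Proof.
split; first by apply/idealP; exists (fun=> 0); rewrite big1 // => i; rewrite mul0r.
move=> _ _ /idealP[c ->] /idealP[d ->]; apply/idealP; exists (fun i => c i - d i).
by rewrite -sumrB; apply: eq_bigr => i _; rewrite mulrBl.
Qed.

HB.instance Definition _ gs :=
  GRing.isZmodClosed.Build R (ideal gs) (ideal_zmod_closed gs).

Lemma ideal_mull gs a f : f \in ideal gs -> a * f \in ideal gs.
Proof.
move=> /idealP[c ->]; apply/idealP; exists (fun i => a * c i).
by rewrite mulr_sumr; apply: eq_bigr => i _; rewrite mulrA.
Qed.

(* The quotient ring R / (gs).  Unlike {ideal_quot _}, this does not require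
   the ideal to be proper, so the quotient may be the zero ring. *)
Definition quot_ring (gs : seq R) : Type := {ideal_quot (ideal gs)}.

Section Ring.
Variable gs : seq R.
Local Notation Q := (quot_ring gs).

HB.instance Definition _ := GRing.Zmodule.on Q.

Definition proj (f : R) : Q := \pi_({ideal_quot (ideal gs)}) f.
Definition quot_one : Q := proj 1.
Definition quot_mul (x y : Q) : Q :=
  proj (repr (x : {ideal_quot (ideal gs)}) * repr (y : {ideal_quot (ideal gs)})).

Lemma proj_eq f g : proj f = proj g <-> f - g \in ideal gs.
Proof. by rewrite Quotient.idealrBE /proj; split=> [->|/eqP]. Qed.

Lemma proj_surj (x : Q) : exists f, x = proj f.
Proof. by exists (repr (x : {ideal_quot (ideal gs)})); rewrite /proj reprK. Qed.

Lemma projM f g : quot_mul (proj f) (proj g) = proj (f * g).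
Proof.
rewrite /quot_mul; set f' := repr _; set g' := repr _.
have /proj_eq If : proj f' = proj f by rewrite /proj reprK.
have /proj_eq Ig : proj g' = proj g by rewrite /proj reprK.
apply/proj_eq.
have -> : f' * g' - f * g = g' * (f' - f) + f * (g' - g).
  by rewrite !mulrBr addrA (mulrC g' f') (mulrC g' f) subrK.
by rewrite rpredD // ideal_mull.
Qed.

Lemma projD f g : proj f + proj g = proj (f + g).
Proof. by rewrite /proj raddfD. Qed.

Fact quot_mulA : associative quot_mul.
Proof.
move=> x y z.
have [[f ->] [[g ->] [h ->]]] :=
  (conj (proj_surj x) (conj (proj_surj y) (proj_surj z))).
by rewrite !projM mulrA.
Qed.

Fact quot_mulC : commutative quot_mul.
Proof. by move=> x y; rewrite /quot_mul mulrC. Qed.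

Fact quot_mul1 : left_id quot_one quot_mul.
Proof. by move=> x; have [f ->] := proj_surj x; rewrite projM mul1r. Qed.

Fact quot_mulDl : left_distributive quot_mul +%R.
Proof.
move=> x y z.
have [[f ->] [[g ->] [h ->]]] :=
  (conj (proj_surj x) (conj (proj_surj y) (proj_surj z))).
by rewrite projD !projM projD mulrDl.
Qed.

HB.instance Definition _ := GRing.Zmodule_isComPzRing.Build Q
  quot_mulA quot_mulC quot_mul1 quot_mulDl.

End Ring.
End IdealQuotient.

(* The weak Lefschetz property of a graded ring A whose degree i component is
   the set gr i. *)
Definition WLP (A : pzRingType) (gr : nat -> A -> Prop) : Prop :=
  exists2 l : A, gr 1 l &
  forall i : nat,
    (forall a b, gr i a -> gr i b -> l * a = l * b -> a = b) \/
    (forall b, gr i.+1 b -> exists2 a, gr i a & l * a = b).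

Section CoverAlgebra.
Variables (k : fieldType) (n : nat) (e : rel 'I_n).

Definition square_gens : seq {mpoly k[n]} := [seq 'X_i ^+ 2 | i : 'I_n].

Definition cover_gens : seq {mpoly k[n]} :=
  [seq \prod_(i in C) 'X_i | C : {set 'I_n} in vertex_cover e].

(* A_c(G) = k[x_1, ..., x_n] / ((x_1^2, ..., x_n^2) + J(G)) *)
Definition cover_algebra : comPzRingType :=
  quot_ring (square_gens ++ cover_gens).

(* The ideal is homogeneous, so the degree i component of the quotient consists
   of the classes of the homogeneous polynomials of degree i. *)
Definition cover_grading (i : nat) (a : cover_algebra) : Prop :=
  exists2 f : {mpoly k[n]}, f \is i.-homog & a = proj _ f.

End CoverAlgebra.

(* Main.v *)
Require Import Defs.
From mathcomp Require Import all_boot all_order all_algebra.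
From mathcomp Require Import ring.

(* The classes of the squarefree monomials x_S with S not a vertex cover form a
   basis of the cover algebra A.  In a well-covered tree both colour classes S
   and ~: S are maximal independent sets, so n = 2m with m = #|S|, every
   independent set has at most m vertices, and König's theorem gives a perfect
   matching.  The decisive degree is [A]_(m-1) -> [A]_m.  It is never injective:
   some f of degree m-1 satisfies l f = x_S +- x_(~: S) modulo the squares, both
   monomials vanish in A, and no cover has size m-1.  It is not surjective once
   m >= 3: a functional that kills the image of l and is supported on m-sets
   other than the transversals of the matching descends to [A]_m, because every
   cover of size m is a transversal.  The cases m = 1 and m = 2 are K2 and P4. *)

Set Implicit Arguments.
Unset Strict Implicit.
Unset Printing Implicit Defensive.

(** * Matchings and colourings of forests *)

Section Forests.
Variables (V : finType) (e : rel V).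
Hypotheses (e_sym : symmetric e) (e_irr : irreflexive e) (e_acyc : acyclic e).

Lemma independentP (A : {set V}) :
  reflect (forall x y, x \in A -> y \in A -> e x y = false) (independent e A).
Proof.
apply: (iffP forall_inP) => [iA x y xA yA | iA x xA].
  by apply/negbTE; apply: (forall_inP (iA x xA)).
by apply/forall_inP => y yA; rewrite iA.
Qed.

Lemma vertex_coverE (C : {set V}) : vertex_cover e C = independent e (~: C).
Proof.
apply/forallP/independentP => [cC x y | iC x].
  rewrite !inE => /negPf xC /negPf yC; have := forallP (cC x) y.
  by rewrite xC yC implybF => /negPf.
apply/forallP => y; apply/implyP => exy; apply: contraLR (exy).
by rewrite negb_or => /andP[xC yC]; rewrite iC ?inE.
Qed.

(** If every vertex of [U] had two neighbours in [U], a path could be prolonged inside [U] forever,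
    since a repeated vertex would close a cycle of length at least 3. An isolated [w] also
    qualifies, with [p] arbitrary. *)
Lemma forest_leaf (U : {set V}) : U != set0 ->
  exists2 w, w \in U & exists p, forall y, y \in U -> e w y -> y = p.
Proof.
case/set0Pn => u uU.
have [/existsP[w /andP[wU /existsP[p /forall_inP wp]]]|] := boolP
    [exists w, (w \in U) && [exists p, forall y in U, e w y ==> (y == p)]].
  by exists w => //; exists p => y yU ewy; apply/eqP; apply: implyP (wp y yU) ewy.
rewrite negb_exists => /forallP noleaf.
have next w p : w \in U -> exists y, [/\ y \in U, e w y & y != p].
  move=> wU; have := noleaf w; rewrite wU /= negb_exists => /forallP/(_ p).
  by rewrite negb_forall => /existsP[y]; rewrite !negb_imply => /and3P[]; exists y.
have long n : exists x s, [/\ path e x s, uniq (x :: s), {subset x :: s <= U} & size s = n].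
  elim: n => [|n [x [s [px us sU sz]]]].
    by exists u, [::]; split=> // y; rewrite inE => /eqP ->.
  have xU : x \in U by apply: sU; rewrite mem_head.
  (* Avoiding the preceding vertex of the path makes any repetition a cycle of length at least 3. On
     a one-vertex path the default [x] excludes nothing. *)
  have [y [yU exy ys]] := next x (head x s) xU.
  have [yxs|yxs] := boolP (y \in x :: s); last first.
    exists y, (x :: s); split=> //=; first by rewrite e_sym exy.
    - by move: us yxs => /= -> ->.
    - by move=> z; rewrite inE => /predU1P[->|/sU].
    by rewrite sz.
  have yx : y != x by apply: contraTneq exy => ->; rewrite e_irr.
  move: yxs; rewrite inE (negPf yx) /= => yin.
  case/splitPr: yin px us ys {sz sU} => [[|z s1] s2]; first by rewrite /= eqxx.
  rewrite -cat_rcons cat_path -cat_cons cat_uniq => /andP[px _] /andP[us _] _.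
  suff /e_acyc : ucycle e (x :: rcons (z :: s1) y) by rewrite /= size_rcons.
  by rewrite /ucycle us andbT /cycle rcons_path px last_rcons e_sym.
have [x [s [_ us _ sz]]] := long #|V|.
by have := max_card (mem (x :: s)); rewrite (card_uniqP us) /= sz ltnn.
Qed.

(** The induction hypothesis covers all proper subsets because the matching argument removes [p]
    together with [w]. *)
Lemma forest_ind (P : {set V} -> Prop) :
  P set0 ->
  (forall (U : {set V}) w p, w \in U -> (forall y, y \in U -> e w y -> y = p) ->
     (forall U' : {set V}, U' \proper U -> P U') -> P U) ->
  forall U, P U.
Proof.
move=> P0 PS U; have [n] := ubnP #|U|; elim: n U => // n IHn U ltU.
have [->//|/forest_leaf[w wU [p wp]]] := eqVneq U set0.
apply: PS wU wp _ => U' /proper_card ltU'; apply: IHn.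
exact: leq_trans ltU' ltU.
Qed.

Lemma independentU1 (I U : {set V}) w p :
  w \in U -> (forall y, y \in U -> e w y -> y = p) ->
  I \subset U -> p \notin I -> independent e I -> independent e (w |: I).
Proof.
move=> wU wp /subsetP IU pI /independentP iI; apply/independentP => x y.
have wI z : z \in I -> e w z = false.
  by move=> zI; apply: contraNF pI => /wp <- //; apply: IU.
by case/setU1P=> [->|xI] /setU1P[->|yI]; [exact: e_irr|exact: wI|rewrite e_sym wI|exact: iI].
Qed.

(** By induction, [w] joins the class that does not contain its only possible neighbour [p]. *)
Lemma forest_bipartite (U : {set V}) :
  exists A : {set V}, [/\ A \subset U, independent e A & independent e (U :\: A)].
Proof.
elim/forest_ind: U => [|U w p wU wp IH].
  by exists set0; rewrite set0D sub0set; split=> //; apply/independentP => x y; rewrite inE.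
have [|A [AU iA iA']] := IH (U :\ w); first by rewrite properD1.
have AU' := subset_trans AU (subsetDl _ _).
have [pA|pA] := boolP (p \in A).
  exists A; split=> //.
  have -> : U :\: A = w |: ((U :\ w) :\: A).
    apply/setP => x; rewrite !inE; case: eqVneq => //= ->; rewrite wU andbT.
    by apply/negP => /(subsetP AU); rewrite !inE eqxx.
  apply: (independentU1 wU wp) => //; last by rewrite inE pA.
  by rewrite !subDset subsetU // subsetUr orbT.
exists (w |: A); split; first by rewrite subUset sub1set wU.
  exact: independentU1 wU wp _ pA iA.
suff -> : U :\: (w |: A) = (U :\ w) :\: A by [].
by apply/setP => x; rewrite !inE negb_or andbA [(x \notin A) && _]andbC.
Qed.

(* König's theorem for forests: the fixed points of [s] are the vertices that
   the matching misses. *)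
Lemma forest_konig (U : {set V}) :
  exists s : V -> V, exists I : {set V},
  [/\ involutive s, forall v, s v != v -> v \in U /\ e v (s v),
      I \subset U, independent e I & #|U| + #|[set v in U | s v == v]| <= #|I|.*2].
Proof.
elim/forest_ind: U => [|U w p wU wp IH].
  exists id, set0; split; rewrite ?sub0set //.
  - by move=> v; rewrite eqxx.
  - by apply/independentP => x y; rewrite inE.
  by rewrite setIdE set0I !cards0.
(* If [p] is a neighbour in [U], match it with [w]: the left side of the bound grows by 2 for the
   two vertices. Otherwise [w] stays unmatched and counts twice, in [U] and as a fixed point. Either
   way adding [w] to [I] pays for it. *)
have [/andP[ewp pU]|np] := boolP (e w p && (p \in U)).
  have [|s [I [sK se IU iI cI]]] := IH (U :\ w :\ p).
    by apply: sub_proper_trans (properD1 wU); rewrite subD1set.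
  have wpn : w != p by apply: contraTneq ewp => ->; rewrite e_irr.
  have fix_out v : v \notin U :\ w :\ p -> s v = v.
    by move=> vU; apply/eqP; apply: contraNT vU => /se[].
  have sw : s w = w by rewrite fix_out // !inE eqxx andbF.
  have sp : s p = p by rewrite fix_out // !inE eqxx.
  have swp v : v != w -> v != p -> (s v == w = false) * (s v == p = false).
    move=> vw vp; split; apply/eqP => E; have /eqP := sK v;
      by rewrite E (sw, sp) eq_sym ((negPf vw), (negPf vp)).
  pose t v := if v == w then p else if v == p then w else s v.
  exists t, (w |: I); split.
  - move=> v; rewrite /t; have [->|vw] := eqVneq v w; first by rewrite (eq_sym p) (negPf wpn) eqxx.
    have [->|vp] := eqVneq v p; first by rewrite eqxx.
    by rewrite !swp // sK.
  - move=> v; rewrite /t; have [->//|vw] := eqVneq v w.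
    have [->|vp] := eqVneq v p; first by rewrite e_sym.
    by move/se; rewrite !inE vw vp.
  - by rewrite subUset sub1set wU (subset_trans IU) // setDDl subsetDl.
  - apply: independentU1 wU wp _ _ iI; first by rewrite (subset_trans IU) // setDDl subsetDl.
    by apply/negP => /(subsetP IU); rewrite !inE eqxx.
  have -> : [set v in U | t v == v] = [set v in U :\ w :\ p | s v == v].
    apply/setP => v; rewrite !inE /t; have [->|vw] := eqVneq v w.
      by rewrite (eq_sym p) (negPf wpn) !andbF.
    by have [->|vp] := eqVneq v p; rewrite ?(negPf wpn) ?andbF.
  rewrite cardsU1 (cardsD1 w U) wU (cardsD1 p (U :\ w)) !inE pU (eq_sym p) wpn.
  have -> : w \notin I by apply/negP => /(subsetP IU); rewrite !inE eqxx andbF.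
  by rewrite !add1n doubleS !addSn !ltnS.
have [|s [I [sK se IU iI cI]]] := IH (U :\ w); first by rewrite properD1.
have sw : s w = w by apply/eqP; apply: contraT => /se[]; rewrite !inE eqxx.
exists s, (w |: I); split=> //.
- by move=> v /se[]; rewrite inE => /andP[_ ->].
- by rewrite subUset sub1set wU (subset_trans IU) // subsetDl.
(* Vacuous, as [w] has no neighbour in [U]; it lets [w] itself play the part of [p] in
   [independentU1]. *)
- have wp' y : y \in U -> e w y -> y = w.
    by move=> yU ewy; move: (wp y yU ewy) => Ey; rewrite -Ey ewy yU in np.
  apply: (independentU1 wU wp') iI; first by rewrite (subset_trans IU) // subsetDl.
  by apply/negP => /(subsetP IU); rewrite !inE eqxx.
rewrite (cardsD1 w [set v in U | _]) inE wU sw eqxx.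
have -> : [set v in U | s v == v] :\ w = [set v in U :\ w | s v == v].
  by apply/setP => v; rewrite !inE andbA.
rewrite cardsU1 (cardsD1 w U) wU.
have -> : w \notin I by apply/negP => /(subsetP IU); rewrite !inE eqxx.
by rewrite !add1n doubleS addSn addnS !ltnS.
Qed.

End Forests.

(** * Well-covered trees: perfect matching and small cases *)

Lemma connected_neighbor (V : finType) (e : rel V) (x : V) :
  1 < #|V| -> (forall x y, connect e x y) -> exists y, e x y.
Proof.
case/card_gt1P => a [b [_ _ ab]] conn.
have [y yx] : exists y, y != x.
  by have [ax|] := eqVneq a x; [exists b; rewrite -ax eq_sym | exists a].
case/connectP: (conn x y) yx => -[|z s] /=; first by move=> _ ->; rewrite eqxx.
by case/andP; exists z.
Qed.

(** Every vertex has a neighbour, which lies in the other colour class, so both classes are maximal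
    independent sets. *)
Lemma well_covered_tree (V : finType) (e : rel V) :
  symmetric e -> irreflexive e -> 1 < #|V| -> is_tree e -> well_covered e ->
  exists (S : {set V}) (s : V -> V),
  [/\ independent e S, independent e (~: S), #|~: S| = #|S|,
      forall I : {set V}, independent e I -> #|I| <= #|S| &
      involutive s /\ forall v, e v (s v)].
Proof.
move=> e_sym e_irr V_gt1 [_ conn acyc] wc.
have [S [_ iS]] := forest_bipartite e_sym e_irr acyc setT; rewrite setTD => iS'.
have maxS (A : {set V}) : independent e A -> independent e (~: A) ->
    maxset (independent e) A.
  move=> iA iA'; apply/maxsetP; split=> // B iB AB; apply/eqP.
  rewrite eqEsubset AB andbT; apply/subsetP => x xB; apply: contraT => xA.
  have [y exy] := connected_neighbor x V_gt1 conn.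
  have yA : y \in A.
    by apply: contraTT exy => yA; rewrite (independentP _ _ iA') ?inE.
  by move: exy; rewrite (independentP _ _ iB) // (subsetP AB).
have mS := maxS S iS iS'.
have cI (I : {set V}) : independent e I -> #|I| <= #|S|.
  move=> iI; have [B mB IB] := maxset_exists iI.
  by rewrite (wc _ _ mS mB) subset_leq_card.
have cS : #|~: S| = #|S|.
  by apply: wc => //; apply: maxS; rewrite ?setCK.
(* The number of vertices plus the number of unmatched ones is at most twice [#|I|], hence at most
   twice [#|S|], which is the number of vertices. So no vertex is unmatched. *)
have [s [I [sK se _ iI]]] := forest_konig e_sym e_irr acyc setT.
rewrite cardsT -(cardsC S) cS addnn => fixI; exists S, s; split=> //; split=> // v.
apply: (se v _).2; apply: contraTneq fixI => sv.
rewrite -ltnNge (leq_ltn_trans (_ : _ <= #|S|.*2)) ?leq_double ?cI //.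
by rewrite -[X in X < _]addn0 ltn_add2l card_gt0; apply/set0Pn; exists v; rewrite !inE sv eqxx.
Qed.

Lemma bipartite_crossing (V : finType) (e : rel V) (S : {set V}) (s : V -> V) :
  independent e S -> independent e (~: S) -> (forall v, e v (s v)) ->
  forall v, (s v \in S) = (v \notin S).
Proof.
move=> /independentP iS /independentP iS' se v; have [vS|vS] := boolP (v \in S).
  by apply: contraTF (se v) => svS; rewrite iS.
by apply: contraTT (se v) => svS; rewrite iS' ?inE.
Qed.

Lemma graph_iso_enum p (V : finType) (e : rel V) (f : rel 'I_p) (x : 'I_p -> V) :
  injective x -> #|V| = p -> (forall i j, e (x i) (x j) = f i j) -> graph_iso e f.
Proof.
move=> xI cV ef; have [|h hK xK] := inj_card_bij xI; first by rewrite card_ord cV.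
exists h; first by exists x.
by move=> u v; rewrite -ef !xK.
Qed.

(** When [#|S| = 2], exactly one further edge joins the two matching edges: connectedness gives at
    least one, acyclicity at most one. *)
Lemma small_well_covered_tree (V : finType) (e : rel V) (S : {set V}) (s : V -> V) :
  symmetric e -> irreflexive e -> is_tree e ->
  independent e S -> independent e (~: S) -> #|~: S| = #|S| ->
  involutive s -> (forall v, e v (s v)) -> #|S| <= 2 ->
  graph_iso e K2 \/ graph_iso e P4.
Proof.
move=> e_sym e_irr [V_gt0 conn acyc] iS iS' cS sK se.
have sS := bipartite_crossing iS iS' se.
move/independentP: iS => iS; move/independentP: iS' => iS'.
have cV : #|V| = #|S|.*2 by rewrite -(cardsC S) cS addnn.
have sI := can_inj sK.
have ne v w : v \in S -> w \in S -> (s v == w = false) * (w == s v = false).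
  move=> vS wS; rewrite (eq_sym w).
  by split; apply/eqP => E; rewrite -E sS vS in wS.
case cS': #|S| => [|[|[|]]] // _; first by rewrite cV cS' in V_gt0.
  left; have /eqP/cards1P[a Sa] := cS'.
  have aS : a \in S by rewrite Sa inE.
  apply: (@graph_iso_enum _ _ _ _ (fun i => nth a [:: a; s a] i)).
  - move=> i j /eqP; rewrite nth_uniq //; first by move/eqP/val_inj.
    by rewrite /= inE !ne.
  - by rewrite cV cS'.
  by case=> [[|[|]] //= ?] [[|[|]] //= ?]; rewrite /K2 ?e_irr ?se // e_sym se.
right; have /eqP/cards2P[a0 [b0 [ab0 Sab0]]] := cS'.
(* Without an edge between the two pairs, [a0] and [s a0] would form a connected component. The
   naming makes the path [s a], [a], [s b], [b]. *)
have [a [b [ab Sab esb]]] : exists a b, [/\ a != b, S = [set a; b] & e a (s b)].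
  have [eab|eab] := boolP (e a0 (s b0)); first by exists a0, b0.
  have [eba|eba] := boolP (e b0 (s a0)).
    by exists b0, a0; rewrite eq_sym setUC.
  have aS : a0 \in S by rewrite Sab0 !inE eqxx.
  have bS : b0 \in S by rewrite Sab0 !inE eqxx orbT.
  have clos : closed e (mem [:: a0; s a0]).
    apply: intro_closed; first exact: sym_connect_sym.
    move=> x y exy; rewrite !inE => /orP[]/eqP xE; subst x.
      have : s y \in S by rewrite sS; apply: contraTN exy => yS; rewrite iS.
      rewrite Sab0 !inE => /orP[/eqP <-|/eqP sy]; first by rewrite sK eqxx orbT.
      by rewrite -sy sK exy in eab.
    have : y \in S by apply: contraTT exy => yS; rewrite iS' ?inE ?sS ?aS.
    rewrite Sab0 !inE => /orP[->//|/eqP yb].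
    by rewrite yb e_sym (negPf eba) in exy.
  have := closed_connect clos (conn a0 b0); rewrite !inE eqxx /= => /esym.
  by rewrite (eq_sym b0) (negPf ab0) ne.
have aS : a \in S by rewrite Sab !inE eqxx.
have bS : b \in S by rewrite Sab !inE eqxx orbT.
have esab : e (s a) b = false.
  apply/negP => e4; suff /acyc : ucycle e [:: a; s b; b; s a] by [].
  rewrite /ucycle /= esb (e_sym (s b)) se (e_sym b) e4 e_sym se /=.
  by rewrite !inE !(inj_eq sI) !ne // (eq_sym b) (negPf ab).
apply: (@graph_iso_enum _ _ _ _ (fun i => nth a [:: s a; a; s b; b] i)).
- move=> i j /eqP; rewrite nth_uniq //; first by move/eqP/val_inj.
  by rewrite /= !inE !(inj_eq sI) !ne // (negPf ab).
- by rewrite cV cS'.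
have sas u v : u \in S -> v \in S -> e (s u) (s v) = false.
  by move=> uS vS; rewrite iS' // inE sS ?uS ?vS.
case=> [[|[|[|[|]]]] //= ?] [[|[|[|[|]]]] //= ?];
  first [by rewrite e_irr | by rewrite se | by rewrite e_sym se | by rewrite iS |
    by rewrite sas | by rewrite esb | by rewrite e_sym esb | by rewrite esab |
    by rewrite e_sym esab].
Qed.

Import GRing.Theory.
Local Open Scope ring_scope.

(** * The squarefree monomial basis of the cover algebra *)

Lemma mem_ideal (R : comNzRingType) (gs : seq R) (g : R) :
  g \in gs -> g \in ideal gs.
Proof.
move=> gs_g; apply/idealP; exists (fun i => (i == index g gs)%:R).
have lt_g : (index g gs < size gs)%N by rewrite index_mem.
rewrite (bigD1 (Ordinal lt_g)) //= eqxx mul1r nth_index // big1 ?addr0 //.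
by move=> i /negPf i_neq; rewrite (_ : (_ == _ :> nat) = false) ?mul0r.
Qed.

Lemma mesym1_le n (S T : {set 'I_n}) :
  (mesym1 S <= mesym1 T)%MM = (S \subset T).
Proof.
apply/mnm_lepP/subsetP => [le i iS | sub i]; last first.
  by rewrite !mnmE; case: (boolP (i \in S)) => // /sub ->.
by have := le i; rewrite !mnmE iS; case: (i \in T).
Qed.

Lemma mesym1D1 n (S : {set 'I_n}) i :
  i \in S -> mesym1 S = (U_(i) + mesym1 (S :\ i))%MM.
Proof.
move=> iS; apply/mnmP => j; rewrite mnmDE mnm1E !mnmE !inE (eq_sym j).
by case: eqVneq => [<-|_]; rewrite ?iS.
Qed.

Lemma prod_mesym1 n (R : comNzRingType) (S : {set 'I_n}) :
  \prod_(i in S) 'X_i = 'X_[mesym1 S] :> {mpoly R[n]}.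
Proof.
rewrite mpolyXE_id [LHS]big_mkcond /=; apply: eq_bigr => i _.
by rewrite mnmE; case: ifP.
Qed.

Lemma mcoeffMX_nle n (R : nzRingType) (p : {mpoly R[n]}) (m m' : 'X_{1..n}) :
  ~~ (m <= m')%MM -> (p * 'X_[m])@_m' = 0.
Proof.
move=> nle; rewrite [p]mpolyE mulr_suml raddf_sum big1 //= => q _.
rewrite -scalerAl -mpolyXD mcoeffZ mcoeffX; case: eqP => [E|_]; last by rewrite mulr0.
by case/negP: nle; rewrite -E lem_addl.
Qed.

Lemma dhomog1E n (R : nzRingType) (p : {mpoly R[n]}) :
  p \is 1.-homog -> p = \sum_i p@_U_(i) *: 'X_i.
Proof.
move=> hp; apply/mpolyP => m; rewrite raddf_sum /=.
have [/eqP/mdeg1P[i /eqP ->]|dm] := eqVneq (mdeg m) 1%N.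
  rewrite (bigD1 i) //= mcoeffZ mcoeffXU eqxx mulr1 big1 ?addr0 // => j /negPf ji.
  by rewrite mcoeffZ mcoeffXU ji mulr0.
rewrite (dhomog_nemf_coeff hp dm) big1 // => i _; rewrite mcoeffZ mcoeffX.
by case: eqP => [E|_]; rewrite ?mulr0 //; rewrite -E mdeg1 in dm.
Qed.

(** A variable outside [S] does not divide x_S. Multiplication by [l] thus becomes a linear system
    on the squarefree coefficients alone. *)
Lemma mcoeff_linM n (R : comNzRingType) (l f : {mpoly R[n]}) (S : {set 'I_n}) :
  l \is 1.-homog ->
  (l * f)@_(mesym1 S) = \sum_(i in S) l@_U_(i) * f@_(mesym1 (S :\ i)).
Proof.
move=> hl; rewrite {1}(dhomog1E hl) mulr_suml raddf_sum /= [RHS]big_mkcond /=.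
apply: eq_bigr => i _; rewrite -scalerAl mcoeffZ -commr_mpolyX.
case: ifP => iS; first by rewrite (mesym1D1 iS) mcoeffMX.
by rewrite mcoeffMX_nle ?mulr0 // -mesym1_set1 mesym1_le sub1set iS.
Qed.

(** The ideal is monomial, so membership is tested monomial by monomial; those outside it are
    exactly the x_S with [S] not a cover. *)
Lemma cover_idealP n (k : fieldType) (e : rel 'I_n) (f : {mpoly k[n]}) :
  reflect (forall S, ~~ vertex_cover e S -> f@_(mesym1 S) = 0)
    (f \in ideal (square_gens k n ++ cover_gens k e)).
Proof.
apply: (iffP idP) => [/idealP[c ->] S nS | f0].
  rewrite raddf_sum big1 //= => i _.
  have: (square_gens k n ++ cover_gens k e)`_i \in square_gens k n ++ cover_gens k e.
    exact: mem_nth.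
  rewrite mem_cat => /orP[/mapP[j _ ->]|/mapP[C]].
    rewrite mpolyXn mcoeffMX_nle //; apply/negP => /mnm_lepP/(_ j).
    by rewrite mulmnE mnm1E eqxx !mnmE; case: (j \in S).
  rewrite mem_enum => cC ->.
  rewrite prod_mesym1 mcoeffMX_nle // mesym1_le; apply: contra nS => /subsetP CS.
  apply/forallP => x; apply/forallP => y; apply/implyP => exy.
  by case/orP: (implyP (forallP (forallP cC x) y) exy) => /CS ->; rewrite ?orbT.
rewrite [f]mpolyE rpred_sum // => m _.
have [/existsP[i mi]|] := boolP [exists i, 1 < m i]%N.
  have le2 : (U_(i) *+ 2 <= m)%MM.
    apply/mnm_lepP => j; rewrite mulmnE mnm1E.
    by case: eqVneq => [<-|_]; rewrite ?mul0n ?mul1n.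
  rewrite -(submK le2) mpolyXD scalerAl ideal_mull // mem_ideal // mem_cat.
  apply/orP; left; rewrite -mpolyXn; apply: map_f; exact: mem_enum.
rewrite negb_exists => /forallP sqf.
have Em : m = mesym1 [set i | 0 < m i]%N.
  by apply/mnmP => i; rewrite mnmE inE; case: (m i) (sqf i) => [|[]].
rewrite Em; set S := [set i | _].
have [cS|/f0 ->] := boolP (vertex_cover e S); last by rewrite scale0r rpred0.
rewrite -mul_mpolyC ideal_mull // mem_ideal // mem_cat; apply/orP; right.
by apply/mapP; exists S; rewrite ?mem_enum ?prod_mesym1.
Qed.

Definition sqfree_poly n (R : comNzRingType) d (f : {set 'I_n} -> R) : {mpoly R[n]} :=
  \sum_(S : {set 'I_n} | #|S| == d) f S *: 'X_[mesym1 S].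

Lemma sqfree_poly_homog n (R : comNzRingType) d (f : {set 'I_n} -> R) :
  sqfree_poly d f \is d.-homog.
Proof.
apply: rpred_sum => S /eqP cS; rewrite dhomogZ // dhomogX.
by apply/eqP; rewrite -cS; apply: mdeg_mesym1.
Qed.

Lemma mcoeff_sqfree n (R : comNzRingType) d (f : {set 'I_n} -> R) (S : {set 'I_n}) :
  #|S| = d -> (sqfree_poly d f)@_(mesym1 S) = f S.
Proof.
move=> cS; rewrite raddf_sum (bigD1 S) ?cS //= mcoeffZ mcoeffX eqxx mulr1.
rewrite big1 ?addr0 // => T /andP[_ /negPf TS]; rewrite mcoeffZ mcoeffX.
by case: eqP => [/inj_mesym1 E|_]; [rewrite E eqxx in TS | rewrite mulr0].
Qed.

Lemma mcoeff_sqfree_eq0 n (R : comNzRingType) d (f : {mpoly R[n]}) (S : {set 'I_n}) :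
  f \is d.-homog -> #|S| != d -> f@_(mesym1 S) = 0.
Proof.
move=> hf cS; rewrite (dhomog_nemf_coeff hf) //.
by apply: contra cS => /eqP <-; apply/eqP; rewrite [RHS]mdeg_mesym1.
Qed.

(** * Multiplication by a linear form as a linear system indexed by vertex sets *)

Lemma cover_eqP n (k : fieldType) (e : rel 'I_n) (f g : {mpoly k[n]}) :
  (proj _ f = proj _ g :> cover_algebra k e) <->
  (forall S, ~~ vertex_cover e S -> f@_(mesym1 S) = g@_(mesym1 S)).
Proof.
split=> [/proj_eq/cover_idealP fg S /fg|fg].
  by rewrite mcoeffB => /eqP; rewrite subr_eq0 => /eqP.
by apply/proj_eq/cover_idealP => S /fg; rewrite mcoeffB => ->; rewrite subrr.
Qed.

Lemma cover_mulP n (k : fieldType) (e : rel 'I_n) (l f g : {mpoly k[n]}) :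
  l \is 1.-homog ->
  ((proj _ l : cover_algebra k e) * (proj _ f : cover_algebra k e) = proj _ g) <->
  (forall S, ~~ vertex_cover e S ->
     \sum_(i in S) l@_U_(i) * f@_(mesym1 (S :\ i)) = g@_(mesym1 S)).
Proof.
move=> hl; rewrite [_ * _]projM cover_eqP.
by split=> E S /E; rewrite mcoeff_linM.
Qed.

(** The form with coefficients [f] is killed by [l] in the algebra, and its coefficient at the
    non-cover [S] shows that its class is nonzero. *)
Lemma not_injective n (k : fieldType) (e : rel 'I_n) (l : {mpoly k[n]}) d
    (f : {set 'I_n} -> k) (S : {set 'I_n}) :
  l \is 1.-homog -> ~~ vertex_cover e S -> #|S| = d -> f S != 0 ->
  (forall T, ~~ vertex_cover e T -> #|T| = d.+1 ->
     \sum_(i in T) l@_U_(i) * f (T :\ i) = 0) ->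
  ~ (forall a b : cover_algebra k e, cover_grading d a -> cover_grading d b ->
       (proj _ l : cover_algebra k e) * a = (proj _ l : cover_algebra k e) * b ->
       a = b).
Proof.
move=> hl nS cS fS0 f0 inj.
have /cover_eqP/(_ S nS) :
    proj _ (sqfree_poly d f) = proj _ 0 :> cover_algebra k e.
  apply: inj; first by exists (sqfree_poly d f); rewrite ?sqfree_poly_homog.
    by exists 0; rewrite ?dhomog0.
  rewrite [RHS]projM mulr0; apply/cover_mulP => // T nT; rewrite mcoeff0.
  have [cT|cT] := eqVneq #|T| d.+1.
    apply: etrans (f0 T nT cT); apply: eq_bigr => i iT; rewrite mcoeff_sqfree //.
    by move: cT; rewrite (cardsD1 i) iT => -[].
  rewrite big1 // => i iT; rewrite (mcoeff_sqfree_eq0 (sqfree_poly_homog d f)) ?mulr0 //.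
  by apply: contra cT => /eqP <-; rewrite (cardsD1 i) iT.
by rewrite mcoeff_sqfree // mcoeff0 => /eqP; apply/negP.
Qed.

(** Here [phi] is a linear functional on squarefree forms of degree [d.+1]. Vanishing on covers
    makes it descend to the algebra, and the last hypothesis says that it kills each l x_F. Being
    nonzero at x_S, it shows that x_S is not in the image. *)
Lemma not_surjective n (k : fieldType) (e : rel 'I_n) (l : {mpoly k[n]}) d
    (phi : {set 'I_n} -> k) (S : {set 'I_n}) :
  l \is 1.-homog -> #|S| = d.+1 -> phi S != 0 ->
  (forall C, vertex_cover e C -> #|C| = d.+1 -> phi C = 0) ->
  (forall F : {set 'I_n}, #|F| = d -> \sum_(i | i \notin F) l@_U_(i) * phi (i |: F) = 0) ->
  ~ (forall b : cover_algebra k e, cover_grading d.+1 b ->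
       exists2 a, cover_grading d a & (proj _ l : cover_algebra k e) * a = b).
Proof.
move=> hl cS phiS phiC phi0 surj.
case: (surj (proj _ 'X_[mesym1 S])) => [|a [f hf ->]].
  by exists 'X_[mesym1 S]; rewrite // dhomogX -cS; apply/eqP/mdeg_mesym1.
move/(cover_mulP _ _ _ hl) => E; case/negP: phiS; apply/eqP.
have -> : phi S = \sum_(T : {set 'I_n} | #|T| == d.+1)
    phi T * ('X_[mesym1 S] : {mpoly k[n]})@_(mesym1 T).
  rewrite (bigD1 S) ?cS //= mcoeffX eqxx mulr1 big1 ?addr0 // => T /andP[_ /negPf TS].
  by rewrite mcoeffX; case: eqP => [/inj_mesym1 ST|_]; [rewrite ST eqxx in TS | rewrite mulr0].
transitivity (\sum_(T : {set 'I_n} | #|T| == d.+1)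
    \sum_(i in T) phi T * (l@_U_(i) * f@_(mesym1 (T :\ i)))).
  apply: eq_bigr => T /eqP cT; rewrite -mulr_sumr.
  by have [/phiC ->|/E ->] := boolP (vertex_cover e T); rewrite ?mul0r.
(* Pairs of [T] and [i] in [T] are recounted as pairs of [F] and [i] outside [F], with
   [T = i |: F]. *)
rewrite (exchange_big_dep xpredT) //=.
transitivity (\sum_i \sum_(F : {set 'I_n} | (#|F| == d) && (i \notin F))
    f@_(mesym1 F) * (l@_U_(i) * phi (i |: F))).
  apply: eq_bigr => i _; rewrite (reindex_onto (fun F => i |: F) (fun T => T :\ i)) /=.
    apply: eq_big => F; last first.
      by case/andP=> _ /eqP ->; rewrite mulrCA (mulrC (phi _)) mulrCA.
    rewrite setU11 andbT cardsU1; have [iF|iF] := boolP (i \in F).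
      rewrite andbF; apply/negP => /andP[_ /eqP/setP/(_ i)].
      by rewrite !inE iF eqxx.
    by rewrite setU1K // eqxx !andbT.
  by move=> T /andP[_ iT]; rewrite setD1K.
rewrite (exchange_big_dep (fun F : {set 'I_n} => #|F| == d)) /=; last by move=> i F _ /andP[].
rewrite big1 // => F /eqP cF; rewrite -mulr_sumr.
by rewrite (eq_bigl (fun i => i \notin F)) ?phi0 ?mulr0 // => i; rewrite cF eqxx.
Qed.

(* Rescaling [f] by the product of the [lam i] solves the weighted system, but may
   give 0 when some weights vanish; g is the leading term of that rescaling for
   the weights lam + t as t tends to 0. *)
Lemma weighted_solution (T : finType) (k : fieldType) (lam : T -> k)
    (f : {set T} -> k) (P : pred {set T}) :
  (exists F, f F != 0) ->
  (forall G, P G -> \sum_(i in G) f (G :\ i) = 0) ->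
  exists g : {set T} -> k,
  [/\ exists F, g F != 0, forall F, f F = 0 -> g F = 0 &
    forall G, P G -> \sum_(i in G) lam i * g (G :\ i) = 0].
Proof.
move=> [F0 f0] fP; pose Z := [set i | lam i == 0].
(* The number of zero weights in a set is its order of vanishing in t, so [F] realises the lowest
   order on the support of [f]. *)
have [F fF minF] := @arg_minnP _ F0 (fun F => f F != 0) (fun F => #|F :&: Z|) f0.
pose g G := if #|G :&: Z| == #|F :&: Z| then f G * \prod_(i in G :\: Z) lam i else 0.
exists g; split; first 1 last.
- by move=> G G0; rewrite /g G0 mul0r if_same.
- move=> G PG; rewrite (bigID (mem Z)) /= big1 ?add0r; last first.
    by move=> i /andP[_]; rewrite inE => /eqP ->; rewrite mul0r.
  have cG i : i \notin Z -> (G :\ i) :&: Z = G :&: Z.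
    move=> iZ; apply/setP => j; rewrite !inE.
    by case: eqVneq => //= ->; move: iZ; rewrite inE => /negPf ->; rewrite andbF.
  have [c|c] := eqVneq #|G :&: Z| #|F :&: Z|; last first.
    by rewrite big1 // => i /andP[_ iZ]; rewrite /g cG // (negPf c) mulr0.
  transitivity ((\prod_(i in G :\: Z) lam i) * \sum_(i in G) f (G :\ i)); last first.
    by rewrite fP ?mulr0.
  rewrite mulr_sumr [in RHS](bigID (mem Z)) /= [X in _ = X + _]big1 ?add0r; last first.
    (* Deleting a zero-weight element from [G] goes below the minimal order, where [f] vanishes. *)
    move=> i /andP[iG iZ]; have [->|fi] := eqVneq (f (G :\ i)) 0; first by rewrite mulr0.
    have := minF _ fi; rewrite -c setIDAC (cardsD1 i (G :&: Z)) in_setI iG iZ.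
    by rewrite ltnn.
  apply: eq_bigr => i /andP[iG iZ]; rewrite /g cG // c eqxx.
  rewrite (bigD1 i (P := fun j => j \in G :\: Z)) ?inE ?iG ?andbT //=; last by rewrite inE in iZ.
  rewrite -mulrA [f _ * _]mulrC; congr (_ * (_ * _)); apply: eq_bigl => j.
  by rewrite !inE; case: (j == i); rewrite /= ?andbF ?andbT.
exists F; rewrite /g eqxx mulf_neq0 // prodf_seq_neq0; apply/allP => i _.
by apply/implyP; rewrite !inE => /andP[].
Qed.

(** * Solutions of the unweighted systems *)

(* The weight (-1)^j j! (d-j)!, where j = |F :&: S|, solves the recurrence
   j w(j-1) + (d+1-j) w(j) = 0 for 0 < j <= d. *)
Definition alt_vec (k : fieldType) (T : finType) (S : {set T}) d (F : {set T}) : k :=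
  (-1) ^+ #|F :&: S| * (#|F :&: S|`! * (d - #|F :&: S|)`!)%:R.

Lemma alt_vec_neq0 (k : fieldType) (T : finType) (S F : {set T}) d :
  [pchar k] =i pred0 -> alt_vec k S d F != 0.
Proof.
move=> char0; rewrite mulf_neq0 ?signr_eq0 // ((pcharf0P k).1 char0).
by rewrite -lt0n muln_gt0 !fact_gt0.
Qed.

(** Let [G] have p+1 elements in [S] and q+1 outside, so d = p+q+1. The p+1 deletions inside [S] and
    the q+1 deletions outside contribute the same product of factorials with opposite signs. If [G]
    lay on one side, only one kind of term would occur. *)
Lemma alt_vec_sum (k : fieldType) (T : finType) (S G : {set T}) d :
  #|G| = d.+1 -> ~~ (G \subset S) -> ~~ (G \subset ~: S) ->
  \sum_(i in G) alt_vec k S d (G :\ i) = 0.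
Proof.
move=> cG; rewrite -setD_eq0 -card_gt0 -[G \subset ~: S]disjoints_subset -setI_eq0 -card_gt0.
have : (#|G :&: S| + #|G :\: S| = d.+1)%N by rewrite cardsID.
case Ep: #|G :&: S| => [|p] //; case Eq: #|G :\: S| => [|q] // + _ _.
rewrite addSn addnS => -[Ed].
rewrite (bigID (mem S)) /= (eq_bigr (fun=> (-1) ^+ p * (p`! * q.+1`!)%:R)); last first.
  move=> i /andP[iG iS]; have := Ep; rewrite (cardsD1 i) inE iG iS add1n => -[].
  by rewrite /alt_vec setIDAC => ->; rewrite -Ed -addnS addKn.
rewrite [X in _ + X](eq_bigr (fun=> (-1) ^+ p.+1 * (p.+1`! * q`!)%:R)); last first.
  move=> i /andP[iG iS]; rewrite /alt_vec.
  suff -> : (G :\ i) :&: S = G :&: S by rewrite Ep -Ed -addSn addKn.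
  by apply/setP => j; rewrite !inE; case: eqVneq => //= ->; rewrite (negPf iS) andbF.
rewrite !sumr_const.
rewrite (_ : #|_| = p.+1); last by rewrite -Ep; apply: eq_card => i; rewrite !inE.
rewrite (_ : #|_| = q.+1); last by rewrite -Eq; apply: eq_card => i; rewrite !inE andbC.
have fE : (p`! * q.+1`! * p.+1 = p.+1`! * q`! * q.+1)%N by rewrite !factS; ring.
by rewrite -[_ *+ p.+1]mulr_natr -[_ *+ q.+1]mulr_natr -!mulrA -!natrM fE exprS
  mulN1r mulNr subrr.
Qed.

(* [s] matches S with its complement, so the pairs {v, s v} are indexed by S. *)
Section Pairing.
Variables (k : fieldType) (T : finType) (S : {set T}) (s : T -> T).
Hypotheses (sK : involutive s) (sS : forall v, (s v \in S) = (v \notin S)).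

Definition occ (v : T) (G : {set T}) : nat := (v \in G) + (s v \in G).
Definition sgn_occ (v : T) (G : {set T}) : k := (v \in G)%:R - (s v \in G)%:R.

Lemma big_pairing (R : Type) (idx : R) (op : Monoid.com_law idx) (F : T -> R) :
  \big[op/idx]_i F i = \big[op/idx]_(v in S) op (F v) (F (s v)).
Proof.
rewrite big_split (bigID (mem S)) /=; congr (op _ _).
rewrite (reindex_inj (can_inj sK)) /=; apply: eq_bigl => v.
by rewrite sS negbK.
Qed.

Lemma card_pairing (G : {set T}) : #|G| = (\sum_(v in S) occ v G)%N.
Proof.
rewrite -sum1_card big_mkcond big_pairing; apply: eq_bigr => v _.
by rewrite /occ; case: ifP; case: ifP.
Qed.

Lemma in_setU1_pair x v F : x \in S -> v \in S -> 
  ((s v \in s x |: F) = (v == x) || (s v \in F)) * ((s v \in x |: F) = (s v \in F)) *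
  ((v \in s x |: F) = (v \in F)) * ((v \in x |: F) = (v == x) || (v \in F)).
Proof.
move=> xS vS; rewrite !in_setU1 (inj_eq (can_inj sK)).
have -> : (s v == x) = false by apply/eqP => E; rewrite -E sS vS in xS.
have -> : (v == s x) = false by apply/eqP => E; rewrite E sS xS in vS.
by [].
Qed.

Variables a b c : T.
Hypotheses (aS : a \in S) (bS : b \in S) (cS : c \in S).
Hypotheses (ab : a != b) (bc : b != c) (ca : c != a).

Definition rest : {set T} := S :\ a :\ b :\ c.

(** The Vandermonde product. For occupancies of total 3 it is 0 at (1,1,1) and 2 or -2 at the
    permutations of (2,1,0), which are the coefficients wanted because y_v^2 reduces to 2 x_v x_(s
    v). *)
Definition vdm (x y z : k) : k := (x - y) * (y - z) * (z - x).

(* The coefficients of (y_a - y_b)(y_b - y_c)(y_c - y_a), with y_v = x_v + x_(s v),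
   times the product of the x_v - x_(s v) over the other pairs, modulo the
   squares.  A vertex cover of size #|S| meets each pair exactly once,
   hence has coefficient 0. *)
Definition pair_vec (G : {set T}) : k :=
  (\prod_(v in rest) sgn_occ v G) *
  vdm (occ a G)%:R (occ b G)%:R (occ c G)%:R.

Lemma restP v : v \in rest -> [/\ v \in S, v != a, v != b & v != c].
Proof. by rewrite !inE => /and4P[]. Qed.

Lemma big_triple (R : Type) (idx : R) (op : Monoid.com_law idx) (F : T -> R) :
  \big[op/idx]_(v in S) F v =
  op (op (F a) (op (F b) (F c))) (\big[op/idx]_(v in rest) F v).
Proof.
rewrite (big_setD1 a) //= (big_setD1 b) /=; last by rewrite !inE eq_sym ab.
rewrite (big_setD1 c) /=; last by rewrite !inE ca eq_sym bc.
by rewrite !Monoid.mulmA.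
Qed.

Lemma pair_vec_cover (C : {set T}) :
  #|C| = #|S| -> (forall v, v \in S -> 0 < occ v C)%N -> pair_vec C = 0.
Proof.
move=> cC occ_gt0.
have occ1 v : v \in S -> occ v C = 1%N.
  (* The occupancies are at least 1 and sum to [#|S|], so this is the equality case. *)
  have /leqif_sum/leqifP : forall v, v \in S -> (1 <= occ v C ?= iff (1 == occ v C))%N.
    by move=> w wS; split; rewrite ?occ_gt0.
  rewrite sum1_card -card_pairing cC ltnn; case: ifP => // /forall_inP E _.
  by move/E/eqP.
by rewrite /pair_vec !occ1 // /vdm subrr !mul0r mulr0.
Qed.

Lemma pair_vec_neq0 : [pchar k] =i pred0 ->
  exists2 G : {set T}, #|G| = #|S| & pair_vec G != 0.
Proof.
(* The pairs of [a], [b], [c] are occupied 2, 1, 0 times and every other pair contributes the sign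
   +1, so the value is -2. *)
move=> char0; exists (s a |: S :\ c).
  by rewrite cardsU1 !inE sS aS andbF (cardsD1 c S) cS.
have nsg v : v \in S -> (s v == c) = false.
  by move=> vS; apply/eqP => E; have := cS; rewrite -E sS vS.
have nsg' v : v \in S -> (v == s a) = false.
  by apply: contraTF => /eqP ->; rewrite sS aS.
rewrite /pair_vec big1 ?mul1r; last first.
  move=> v /restP[vS va _ vc]; rewrite /sgn_occ !inE sS vS nsg' // vc /= andbF orbF.
  by rewrite (inj_eq (can_inj sK)) (negPf va) subr0.
rewrite /occ !inE !sS !(inj_eq (can_inj sK)) !nsg' // aS bS cS !eqxx /=.
rewrite (eq_sym b a) (negPf ab) (negPf ca) bc (eq_sym a c) ca /= !andbF.
have -> : vdm (1 + 1)%:R 1%:R 0%:R = - 2%:R by rewrite /vdm; ring.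
by rewrite oppr_eq0 ((pcharf0P k).1 char0).
Qed.

(** Adding an element of another pair contributes 0 in total: an empty pair gives opposite signs,
    and filling a pair gives 0. Adding an element of the pairs of [a], [b], [c] leaves the product
    over [rest] unchanged, and the antisymmetry of [vdm] cancels these terms. *)
Lemma pair_vec_kernel (F : {set T}) : #|F|.+1 = #|S| ->
  \sum_(i | i \notin F) pair_vec (i |: F) = 0.
Proof.
move=> cF; rewrite big_mkcond big_pairing big_triple /=.
rewrite [X in _ + X]big1 ?addr0; last first.
  move=> x xR; have [xS xa xb xc] := restP xR.
  rewrite /pair_vec /occ !in_setU1_pair // -!(eq_sym x) (negPf xa) (negPf xb) (negPf xc) /=.
  rewrite !(big_setD1 x xR) /= /sgn_occ !in_setU1_pair // eqxx /=.
  under eq_bigr => v /setD1P[vx /restP[vS _ _ _]].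
    rewrite !in_setU1_pair // (negPf vx) /=; over.
  under [X in _ + (if _ then _ * X * _ else _)]eq_bigr => v /setD1P[vx /restP[vS _ _ _]].
    rewrite !in_setU1_pair // (negPf vx) /=; over.
  by case: (x \in F); case: (s x \in F) => /=; ring.
have restE x : x \in [:: a; b; c] ->
    (\prod_(v in rest) sgn_occ v (s x |: F) = \prod_(v in rest) sgn_occ v F) *
    (\prod_(v in rest) sgn_occ v (x |: F) = \prod_(v in rest) sgn_occ v F).
  rewrite !inE => xabc.
  have xS : x \in S by case/or3P: xabc => /eqP ->.
  split; apply: eq_bigr => v /restP[vS /negPf va /negPf vb /negPf vc];
  rewrite /sgn_occ !in_setU1_pair //;
  by case/or3P: xabc => /eqP ->; rewrite ?va ?vb ?vc.
rewrite /pair_vec !restE ?inE ?eqxx ?orbT //.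
(* A nonzero product forces one element of [F] in each other pair. Exactly two elements then remain
   for the pairs of [a], [b], [c], which leaves a finite check. *)
have [->|P0] := eqVneq (\prod_(v in rest) sgn_occ v F) 0.
  by rewrite !mul0r !if_same !addr0.
have occ1 v : v \in rest -> occ v F = 1%N.
  move=> vR; move/prodf_neq0: P0 => /(_ v vR); rewrite /sgn_occ /occ.
  by case: (v \in F); case: (s v \in F); rewrite ?subrr ?eqxx.
have := cF; rewrite card_pairing -sum1_card !big_triple /=.
rewrite [in X in X.+1 = _](eq_bigr _ occ1) -addSn => /addIn.
rewrite /occ !in_setU1_pair // !eqxx /= (eq_sym b) (negPf ab) (eq_sym c b) (negPf bc).
rewrite (eq_sym a c) (negPf ca) /=.
by move: (_ \in F) (_ \in F) (_ \in F) (_ \in F) (_ \in F) (_ \in F)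
  => [] [] [] [] [] [] //= _; rewrite /vdm; ring.
Qed.

End Pairing.

(** * The weak Lefschetz property *)

Lemma vertex_cover_large n (e : rel 'I_n) (S : {set 'I_n}) :
  irreflexive e -> (n <= #|S|.+1)%N -> vertex_cover e S.
Proof.
move=> e_irr cS; rewrite vertex_coverE; apply/independentP => x y xS yS.
have := cardsC S; rewrite card_ord; case E: #|~: S| => [|[|c]] cn.
- by move/cards0_eq: E xS => ->; rewrite inE.
- by move/eqP/cards1P: E xS yS => [z ->]; rewrite !inE => /eqP -> /eqP ->.
have : (#|S| + c.+2 <= #|S| + 1)%N by rewrite cn addn1.
by rewrite leq_add2l.
Qed.

Lemma cover_grading_large n (k : fieldType) (e : rel 'I_n) d (b : cover_algebra k e) :
  irreflexive e -> (n <= d.+1)%N -> cover_grading d b -> b = proj _ 0.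
Proof.
move=> e_irr nd [f hf ->]; apply/cover_eqP => S nS; rewrite mcoeff0.
rewrite (mcoeff_sqfree_eq0 hf) //; apply: contraNneq nS => cS.
by rewrite vertex_cover_large // cS.
Qed.

Lemma surjective_large n (k : fieldType) (e : rel 'I_n) d (l : cover_algebra k e) :
  irreflexive e -> (n <= d.+2)%N ->
  forall b, cover_grading d.+1 b -> exists2 a, cover_grading d a & l * a = b.
Proof.
move=> e_irr nd b /(cover_grading_large e_irr nd) ->.
exists (proj _ 0); first by exists 0; rewrite ?dhomog0.
by have [f ->] := proj_surj l; rewrite [LHS]projM mulr0.
Qed.

(** With two vertices every singleton is a cover, so all positive degrees vanish and even the zero
    form is a Lefschetz element. *)
Lemma K2_WLP (k : fieldType) n (e : rel 'I_n) :
  irreflexive e -> graph_iso e K2 -> WLP (@cover_grading k n e).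
Proof.
move=> e_irr [h h_bij _]; have := bij_eq_card h_bij; rewrite !card_ord => n2.
exists (proj _ 0) => [|i]; first by exists 0; rewrite ?dhomog0.
by right; apply: surjective_large => //; rewrite n2.
Qed.

(** A non-cover misses both ends of some edge; with two elements it is the complement of one of the
    three edges. *)
Lemma P4_noncover n (e : rel 'I_n) (x : 'I_4 -> 'I_n) (S : {set 'I_n}) :
  bijective x -> (forall i j, e (x i) (x j) = P4 i j) ->
  ~~ vertex_cover e S -> #|S| = 2 ->
  [\/ S = [set x (inord 2); x (inord 3)], S = [set x (inord 0); x (inord 3)] |
      S = [set x (inord 0); x (inord 1)]].
Proof.
move=> x_bij ex; have [h hK xK] := x_bij; have xI := bij_inj x_bij.
rewrite negb_forall => /existsP[p]; rewrite negb_forall => /existsP[q].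
rewrite negb_imply negb_or => /and3P[epq pS qS] cS.
have ne i j k l : uniq [:: i; j; k; l] -> x i \notin S -> x j \notin S ->
    S = [set x k; x l].
  move=> u iS jS; apply/eqP; rewrite eqEcard cS cards2; apply/andP; split; last first.
    by case: (_ != _).
  apply/subsetP => z zS; move: zS (iS) (jS); rewrite -(xK z) !inE !(inj_eq xI) => zS niS njS.
  have zi : h z != i by apply: contraNneq niS => <-.
  have zj : h z != j by apply: contraNneq njS => <-.
  have : h z \in [:: i; j; k; l].
    rewrite (_ : (_ \in _) = true) //; apply/idP.
    have -> : [:: i; j; k; l] =i 'I_4; last by [].
    by apply/subset_cardP; [rewrite (card_uniqP u) card_ord | apply/subsetP].
  by rewrite !inE (negPf zi) (negPf zj).
move: epq pS qS; rewrite -(xK p) -(xK q) ex; move: (h p) (h q) => i j ij iS jS.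
have lt m (lm : (m < 4)%N) : Ordinal lm = inord m by apply: val_inj; rewrite /= inordK.
move: i j ij iS jS => [[|[|[|[|i]]]] // li] [[|[|[|[|j]]]] // lj] // _; rewrite !lt => iS jS;
  [apply: Or31|apply: Or31|apply: Or32|apply: Or32|apply: Or33|apply: Or33];
  by apply: (ne _ _ _ _ _ iS jS); rewrite /= !inE -!val_eqE /= !inordK.
Qed.

(** Degree 3 and above vanish, so for the sum of the variables only injectivity from degree 0 and
    surjectivity from degree 1 are left. *)
Lemma P4_WLP (k : fieldType) n (e : rel 'I_n) :
  irreflexive e -> graph_iso e P4 -> WLP (@cover_grading k n e).
Proof.
move=> e_irr [h [x hK xK] eh].
have x_bij : bijective x by exists h.
have xI := bij_inj x_bij.
have ex i j : e (x i) (x j) = P4 i j by rewrite -eh !xK.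
have n4 : n = 4 by have := bij_eq_card x_bij; rewrite !card_ord.
pose l : {mpoly k[n]} := sqfree_poly 1 (fun=> 1).
have hl : l \is 1.-homog := sqfree_poly_homog _ _.
have l1 i : l@_U_(i) = 1 by rewrite -mesym1_set1 mcoeff_sqfree ?cards1.
exists (proj _ l); first by exists l.
case=> [|[|i]]; last by right; apply: surjective_large => //; rewrite n4.
  left=> _ _ [f hf ->] [g hg ->]; rewrite [X in _ = X]projM => /(cover_mulP _ _ _ hl) fg.
  apply/cover_eqP => S nS; have [/cards0_eq ->|cS] := eqVneq #|S| 0%N; last first.
    by rewrite (mcoeff_sqfree_eq0 hf) // (mcoeff_sqfree_eq0 hg).
  have := fg [set x ord0]; rewrite mcoeff_linM // !big_set1 setDv l1 !mul1r; apply.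
  rewrite vertex_coverE; apply/negP => /independentP/(_ (x (inord 1)) (x (inord 2))).
  by rewrite ex !inE !(inj_eq xI) -!val_eqE /= /P4 !inordK //= => /(_ isT isT).
right=> _ [g hg ->].
pose c i j := g@_(mesym1 [set x (inord i); x (inord j)]).
(* With F_i the value at the i-th singleton, this solves F_0 + F_1 = c_01, F_0 + F_3 = c_03, F_2 +
   F_3 = c_23, with F_0 = 0. *)
pose F (T : {set 'I_n}) : k :=
  if x (inord 1) \in T then c 0 1 else if x (inord 3) \in T then c 0 3
  else if x (inord 2) \in T then c 2 3 - c 0 3 else 0.
exists (proj _ (sqfree_poly 1 F)).
  by exists (sqfree_poly 1 F); rewrite ?sqfree_poly_homog.
apply/(cover_mulP _ _ _ hl) => S nS.
have [cS|cS] := eqVneq #|S| 2%N; last first.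
  rewrite (mcoeff_sqfree_eq0 hg) // big1 // => i iS.
  rewrite (mcoeff_sqfree_eq0 (sqfree_poly_homog 1 F)) ?mulr0 //.
  by apply: contra cS => /eqP c1; rewrite (cardsD1 i) iS c1.
rewrite (eq_bigr (fun i => F (S :\ i))); last first.
  move=> i iS; rewrite l1 mul1r mcoeff_sqfree //.
  by move: cS; rewrite (cardsD1 i) iS => -[].
have sum2 i j : i != j -> \sum_(v in [set x i; x j]) F ([set x i; x j] :\ v) =
    F [set x j] + F [set x i].
  move=> ij; rewrite big_setU1 ?inE ?(inj_eq xI) //= big_set1 setU1K ?inE ?(inj_eq xI) //.
  by rewrite setUC setU1K // inE (inj_eq xI) eq_sym.
have ne (i j : nat) : (i < 4)%N -> (j < 4)%N -> (inord i == inord j :> 'I_4) = (i == j).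
  by move=> i4 j4; rewrite -val_eqE /= !inordK.
case: (P4_noncover x_bij ex nS cS) => ->; rewrite sum2 ?ne // /F !inE !(inj_eq xI) !ne //=.
- by rewrite addrC subrK.
- by rewrite addr0.
- by rewrite addr0.
Qed.

Lemma large_matching_not_WLP (k : fieldType) n (e : rel 'I_n) (S : {set 'I_n}) (s : 'I_n -> 'I_n) :
  [pchar k] =i pred0 ->
  independent e S -> independent e (~: S) -> #|~: S| = #|S| ->
  (forall I : {set 'I_n}, independent e I -> #|I| <= #|S|)%N ->
  involutive s -> (forall v, e v (s v)) -> (2 < #|S|)%N ->
  ~ WLP (@cover_grading k n e).
Proof.
move=> char0 iS iS' cS maxS sK se S_gt2 [_ [l hl ->] wlp].
have sS := bipartite_crossing iS iS' se.
have [d Sd] : exists d, #|S| = d.+1 by exists #|S|.-1; rewrite prednK // (ltn_trans _ S_gt2).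
have cn : n = (d.+1 + d.+1)%N by rewrite -[LHS]card_ord -(cardsC S) cS Sd.
case: (wlp d) => {wlp}.
  (* Truncating to size [d] ensures that the weighted solution, whose support lies in that of [f],
     is nonzero at some set of size [d]. *)
  pose f (F : {set 'I_n}) := if #|F| == d then alt_vec k S d F else 0.
  have [|G /andP[nG /eqP cG]|g [[F gF] gf gP]] := @weighted_solution _ _ (fun i => l@_U_(i)) f
      (fun G => ~~ vertex_cover e G && (#|G| == d.+1)).
  - have /card_gt0P[a aS] : (0 < #|S|)%N by rewrite Sd.
    exists (S :\ a); rewrite /f; move: Sd; rewrite (cardsD1 a) aS add1n => -[->].
    by rewrite eqxx alt_vec_neq0.
  - rewrite (eq_bigr (fun i => alt_vec k S d (G :\ i))) => [|i iG]; last first.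
      by move: cG; rewrite /f (cardsD1 i) iG add1n => -[->]; rewrite eqxx.
    (* A set of size [#|S|] contained in [S] or [~: S] is equal to it, hence a cover. *)
    apply: alt_vec_sum => //; apply: contra nG => GS; rewrite vertex_coverE.
      by have /eqP -> : G == S by rewrite eqEcard GS cG Sd leqnn.
    have /eqP -> : G == ~: S by rewrite eqEcard GS cG cS Sd leqnn.
    by rewrite setCK.
  have cF : #|F| = d by apply/eqP; apply: contraNT gF => cF; rewrite gf // /f (negPf cF).
  apply: (not_injective (S := F) hl _ cF gF) => [|T nT cT].
    (* The complement of [F] has [d.+2] vertices, one too many to be independent. *)
    rewrite vertex_coverE; apply/negP => /maxS; rewrite Sd leqNgt => /negP; apply.
    by have := cardsC F; rewrite card_ord [RHS]cn cF addSnnS => /addnI ->.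
  by apply: gP; rewrite nT cT eqxx.
have [a [b [c [[aS bS cS'] [ab bc ca]]]]] := card_gt2P S_gt2.
pose pv := pair_vec k S s a b c.
(* [weighted_solution] deletes elements, whereas the functional adds them; complements exchange the
   two. *)
pose f (H : {set 'I_n}) := if #|~: H| == d.+1 then pv (~: H) else 0.
have [|G cG|g [[F gF] gf gP]] := @weighted_solution _ _ (fun i => l@_U_(i)) f
    (fun G => #|~: G| == d).
- have [G cG G0] := pair_vec_neq0 sK sS aS bS cS' ab bc ca char0.
  by exists (~: G); rewrite /f setCK cG Sd eqxx.
- have cG' : #|~: G|.+1 = #|S| by rewrite (eqP cG) Sd.
  apply: etrans (pair_vec_kernel k sK sS aS bS cS' ab bc ca cG').
  apply: eq_big => i; first by rewrite inE negbK.
  move=> iG; rewrite /f.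
  have -> : ~: (G :\ i) = i |: ~: G by rewrite setCD setUC.
  by rewrite cardsU1 inE iG /= (eqP cG) add1n eqxx.
have cF : #|~: F| = d.+1.
  by apply/eqP; apply: contraNT gF => cF; rewrite gf // /f (negPf cF).
apply: (not_surjective (S := ~: F) (phi := fun G => g (~: G)) hl cF).
- by rewrite setCK.
(* The reweighted functional keeps the zeros of [f], and a cover meets every matching edge, so
   [pair_vec_cover] applies. *)
- move=> C cC Cd; apply: gf; rewrite /f setCK Cd eqxx /pv.
  apply: pair_vec_cover => //; first by rewrite Cd.
  move=> v _; have := implyP (forallP (forallP cC v) (s v)) (se v).
  by rewrite /occ; case: (v \in C); case: (s v \in C).
move=> G cG; have cG' : #|~: ~: G| == d by rewrite setCK cG.
apply: etrans (gP (~: G) cG'); apply: eq_big => i; first by rewrite inE.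
by move=> iG; rewrite setCU setIC -setDE.
Qed.

Theorem corollary6p6 (k : fieldType) (char_k : [pchar k] =i pred0)
    (n : nat) (e : rel 'I_n) (e_sym : symmetric e) (e_irr : irreflexive e)
    (n_ge2 : (2 <= n)%N) (e_tree : is_tree e) (e_wc : well_covered e) :
  WLP (@cover_grading k n e) <-> graph_iso e K2 \/ graph_iso e P4.
Proof.
have [|S [s [iS iS' cS maxS [sK se]]]] := well_covered_tree e_sym e_irr _ e_tree e_wc.
  by rewrite card_ord.
split=> [wlp|[]]; [|exact: K2_WLP|exact: P4_WLP].
apply: (@small_well_covered_tree _ _ S s) => //.
by rewrite leqNgt; apply/negP => /(large_matching_not_WLP char_k iS iS' cS maxS sK se).
Qed.
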